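(* Let $n$ be a positive integer, let $0<p<1$, and let $(\alpha^{(0)},\alpha^{(1)},\dotsc)$ be the Markov chain on $\mathcal{W}(n)$ defined by the card-based stochastic Bulgarian solitaire $\mathscr{B}(n,p)$ with a (possibly random) initial configuration $\alpha^{(0)}\in\mathcal{W}(n)$. Then, for any $\varepsilon_1>0$ and any number of moves $m\ge 1$, $$P\bigl(\forall k\leq m:\ |\alpha_k^{(m)}-E\alpha_k^{(m)}|<\varepsilon_1 np\bigr)>1-2m\exp\left(-\frac{\varepsilon_1^2}{2+\varepsilon_1}np\right)$$ and $$P\bigl(\forall k>m:\ \alpha_k^{(m)}=0\bigr)\geq 1-n(1-p)^m,$$ where $k$ ranges over positive integers.
   Context: $\mathcal{W}(n)$ is the set of weak compositions of $n$: infinite sequences $\alpha=(\alpha_1,\alpha_2,\dotsc)$ of nonnegative integers with sum $n$. The card-based stochastic Bulgarian solitaire $\mathscr{B}(n,p)$ is played with $n$ cards distributed in piles. In each move, every card is picked with probability $p$, independently of all other cards (and independently of the past and of the initial configuration), and the picked cards form a new, possibly empty, pile. As a Markov chain on $\mathcal{W}(n)$, piles are ordered by time of creation, most recent first: if $\alpha^{(t)}=(\alpha_1,\alpha_2,\dotsc)$ and $X_i$ is the number of cards picked from the $i$th pile (so, given $\alpha^{(t)}$, the $X_i\sim\mathrm{Bin}(\alpha_i,p)$ are independent), then $\alpha^{(t+1)}=\bigl(\sum_i X_i,\ \alpha_1-X_1,\ \alpha_2-X_2,\dotsc\bigr)$. Thus $\alpha^{(m)}_k$ is the number of cards, after $m$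 moves, in the $k$th pile counted from the most recently created one. *)

(* Defs.v *)
From HB Require Import structures.
From mathcomp Require Import all_boot all_order all_algebra.
From mathcomp Require Import finmap.
From mathcomp Require Import all_classical all_reals all_analysis.

Set Implicit Arguments.
Unset Strict Implicit.
Unset Printing Implicit Defensive.

Import Order.TTheory GRing.Theory Num.Theory.
Import numFieldNormedType.Exports.

Local Open Scope classical_set_scope.
Local Open Scope ring_scope.

(* A sequence of naturals with a finite sum has finite support, hence [fsfun].
   Entries are indexed from 0: [a k] is the (k+1)-st part, i.e. the size of the
   (k+1)-st most recently created pile. *)
Record weak_comp (n : nat) := WeakComp {
  parts :> {fsfun nat -> nat with 0%N} ;
  parts_sum : (\sum_(k <- finsupp parts) parts k = n)%N }.

Definition one_pile_fun (n : nat) : {fsfun nat -> nat with 0%N} :=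
  [fsfun [fsfun] with 0%N |-> n].

Lemma one_pile_sum n :
  (\sum_(k <- finsupp (one_pile_fun n)) one_pile_fun n k = n)%N.
Proof.
have fE k : one_pile_fun n k = if k == 0%N then n else 0%N.
  by rewrite /one_pile_fun fsfun_withE fsfunE; case: eqP.
have sub : (finsupp (one_pile_fun n) `<=` [fset 0])%fset.
  apply/fsubsetP => k; rewrite mem_finsupp fE inE.
  by case: (k == 0%N).
rewrite (big_fset_incl _ sub); first by rewrite big_seq_fset1 fE.
by move=> k _; rewrite memNfinsupp => /eqP.
Qed.

Definition one_pile (n : nat) : weak_comp n := WeakComp (one_pile_sum n).

(* The countable state space carries the discrete sigma-algebra. *)
HB.instance Definition _ (n : nat) := gen_eqMixin (weak_comp n).
HB.instance Definition _ (n : nat) := gen_choiceMixin (weak_comp n).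
HB.instance Definition _ (n : nat) := isPointed.Build (weak_comp n) (one_pile n).
HB.instance Definition _ (n : nat) :=
  @isMeasurable.Build default_measure_display (weak_comp n)
    discrete_measurable discrete_measurable0
    discrete_measurableC discrete_measurableU.

(* A card is a pair of a nonempty pile and a position in that pile. *)
Definition solitaire_card (n : nat) (a : weak_comp n) : finType :=
  {i : finsupp a & 'I_(a (val i))}.

Definition picked (n : nat) (a : weak_comp n) (S : {set solitaire_card a}) (i : nat) : nat :=
  #|[set c in S | val (tag c) == i]|.

Definition after_move (n : nat) (a : weak_comp n) (S : {set solitaire_card a}) (k : nat) : nat :=
  if k is i.+1 then (a i - picked S i)%N else #|S|.

(* Transition probability from [a] to [b]: total weight of the sets [S] of
   picked cards that lead from [a] to [b], when the cards are picked
   independently with probability [p]. *)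
Definition transition (R : realType) (n : nat) (p : R) (a b : weak_comp n) : R :=
  \sum_(S : {set solitaire_card a} | `[< forall k : nat, b k = after_move S k >])
    \prod_(c : solitaire_card a) (if c \in S then p else 1 - p).

(* Markov property with transition matrix [transition p], with the conditional
   probability given the history multiplied out; the law of [alpha 0] is
   arbitrary. *)
Definition stochastic_bulgarian_solitaire (R : realType) (d : measure_display)
    (T : measurableType d) (P : probability T R) (n : nat) (p : R)
    (alpha : nat -> {RV P >-> weak_comp n}) : Prop :=
  forall (t : nat) (h : nat -> weak_comp n),
    P [set w | forall s, (s <= t.+1)%N -> alpha s w = h s] =
    (P [set w | forall s, (s <= t)%N -> alpha s w = h s]
      * (transition p (h t) (h t.+1))%:E)%E.

(* Main.v *)
Require Import Defs.
From HB Require Import structures.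
From mathcomp Require Import all_boot all_order all_algebra.
From mathcomp Require Import finmap ring lra.
From mathcomp Require Import all_classical all_reals all_analysis.
From mathcomp Require Import measurable_realfun.

Set Implicit Arguments.
Unset Strict Implicit.
Unset Printing Implicit Defensive.

Import Order.TTheory GRing.Theory Num.Theory.
Import numFieldNormedType.Exports.

Local Open Scope classical_set_scope.
Local Open Scope ring_scope.

(* The proof runs on generating functions.  For weights [z_0, z_1, ...] put
   [gen z a = prod_i z_i ^ a_i].  Each card of pile [i] goes to pile [0] with
   probability [p] and to pile [i.+1] with probability [1 - p], independently,
   so one move turns [gen z] into [gen (shift_gen p z)] in expectation, where
   [shift_gen p z i = p * z_0 + (1 - p) * z_(i.+1)].  Once the iterates of
   [shift_gen p] become a constant [c], the expectation is [c ^+ n], whatever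
   the initial configuration.
   Taking [z = x] at [k] and [1] elsewhere gives
   [E x^(alpha_k) = (1 + p (1 - p)^k (x - 1))^n], i.e. a binomial law, to which
   Chernoff's bounds apply; its mean is at most [n p], hence the uniform
   exponent.  Taking [z_i = 1] for [i < m] and [0] otherwise gives
   [(1 - (1 - p)^m)^n] for the probability that no pile is older than [m]
   moves, and Bernoulli's inequality concludes. *)

(** * Chernoff bounds from a binomial generating function *)

(** By the mean value theorem [h] is nondecreasing on [[0, t]]. Applied to the difference of the two
    sides, this yields both exponential inequalities below. *)
Lemma ge0_is_derive_ge0 (R : realType) (h dh : R -> R) (t : R) :
  (forall s : R, is_derive s (1 : R) h (dh s)) -> (forall s, 0 <= dh s) ->
  h 0 = 0 -> 0 <= t -> 0 <= h t.
Proof.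
move=> dhE dh0 h0 t0; rewrite -h0.
apply: (@ger0_derive1_le_cc _ h 0 t) => //.
- by move=> x _; rewrite derive1E; have dx := dhE x; rewrite derive_val.
- apply: continuous_subspaceT => x; apply: differentiable_continuous.
  by apply/derivable1_diffP; have dx := dhE x; exact: ex_derive.
- by rewrite in_itv /= lexx.
- by rewrite in_itv /= lexx t0.
Qed.

(** The derivative of the difference is [1 - expR s * (1 - s)], nonnegative because
    [1 - s <= expR (- s)]. For [t < 2] this is the Padé bound [expR t <= (2 + t) / (2 - t)], which
    makes the upper tail exponent rational. *)
Lemma expR_mul_two_sub_le (R : realType) (t : R) : 0 <= t ->
  expR t * (2 - t) <= 2 + t.
Proof.
move=> t0; rewrite -subr_ge0.
pose h (s : R) : R := 2 + s - expR s * (2 - s).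
pose dh (s : R) : R := 1 - expR s * (1 - s).
apply: (@ge0_is_derive_ge0 _ h dh) => // [s|s|].
- by rewrite /h /dh; apply: is_derive_eq; rewrite /= /GRing.scale /=; ring.
- rewrite /dh subr_ge0 -(ler_pM2l (expR_gt0 (- s))) mulrA -expRD addNr expR0.
  by rewrite mul1r mulr1 expR_ge1Dx.
- by rewrite /h expR0; ring.
Qed.

Lemma expRN_le_quadratic (R : realType) (t : R) : 0 <= t ->
  expR (- t) <= 1 - t + t ^+ 2 / 2.
Proof.
move=> t0; rewrite -subr_ge0.
pose h (s : R) : R := 1 - s + s ^+ 2 / 2 - expR (- s).
pose dh (s : R) : R := expR (- s) - (1 + - s).
apply: (@ge0_is_derive_ge0 _ h dh) => // [s|s|].
- by rewrite /h /dh; apply: is_derive_eq; rewrite /= /GRing.scale /=; field.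
- by rewrite /dh subr_ge0 expR_ge1Dx.
- by rewrite /h oppr0 expR0; ring.
Qed.

(* The strictness in the theorem comes from here. *)
Lemma pgf_lt_expR (R : realType) (n : nat) (r z : R) :
  (0 < n)%N -> 0 < r -> 0 <= 1 + r * (z - 1) -> z != 1 ->
  (1 + r * (z - 1)) ^+ n < expR (n%:R * r * (z - 1)).
Proof.
move=> n0 r0 rz0 z1; rewrite -mulrA [n%:R * _]mulrC expRM_natr ltrXn2r// -?lt0n//.
by apply: expR_gt1Dx; rewrite mulf_neq0 ?subr_eq0// gt_eqF.
Qed.

Section binomial_tails.
Variables (R : realType) (n : nat) (r : R) (f : nat -> R).
Hypotheses (n_gt0 : (0 < n)%N) (r_gt0 : 0 < r) (r_le1 : r <= 1).
Hypothesis f_ge0 : forall j, 0 <= f j.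
Hypothesis f_pgf : forall z, 0 <= z ->
  \sum_(j < n.+1) f j * z ^+ j = (1 + r * (z - 1)) ^+ n.

(** Both sides of [f_pgf] are polynomials in [z] that agree at every natural number, hence are
    equal; the mean is the derivative at 1. *)
Lemma pgf_mean : \sum_(j < n.+1) j%:R * f j = n%:R * r.
Proof.
pose A : {poly R} := \poly_(j < n.+1) f j.
pose B : {poly R} := (1 + r *: ('X - 1)) ^+ n.
have AB : A = B.
  apply/eqP; rewrite -subr_eq0; apply/eqP.
  (* One more point than the size of [A - B], hence more roots than a nonzero polynomial of that
     size can have. *)
  pose s := [seq (i%:R : R) | i <- iota 0 (size (A - B)).+1].
  apply: (@roots_geq_poly_eq0 _ _ s).
  - apply/allP => x /mapP[i _ ->]; rewrite /root hornerD hornerN subr_eq0.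
    rewrite horner_poly f_pgf ?ler0n// /B horner_exp hornerD hornerZ hornerD.
    by rewrite hornerN hornerX -!polyC1 !hornerC.
  - by rewrite map_inj_uniq ?iota_uniq//; exact: mulrIn (oner_neq0 _).
  - by rewrite size_map size_iota.
have := congr1 (fun q => q^`().[1]) AB; rewrite /A /B => AB1.
transitivity (\poly_(j < n.+1) f j)^`().[1].
  rewrite poly_def raddf_sum horner_sum; apply: eq_bigr => i _.
  by rewrite /= derivZ derivXn hornerZ hornerMn hornerXn expr1n mulrC.
rewrite AB1 deriv_exp derivD derivZ derivB derivX -!polyC1 !derivC add0r subr0.
rewrite hornerMn hornerM hornerZ !horner_exp !hornerD hornerZ.
rewrite hornerD hornerN hornerX !hornerC.
by rewrite subrr mulr0 addr0 expr1n !mulr1 mulr_natl.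
Qed.

(* Markov's inequality for [expR (t * X)]. *)
Lemma pgf_markov (P : pred nat) (t c : R) : t != 0 ->
  (forall j, P j -> c <= t * j%:R) ->
  \sum_(j < n.+1 | P j) f j < expR (n%:R * r * (expR t - 1) - c).
Proof.
move=> t0 Pc; rewrite expRD.
apply: (@le_lt_trans _ _ ((\sum_(j < n.+1) f j * expR t ^+ j) * expR (- c))).
  rewrite mulr_suml big_mkcond; apply: ler_sum => j _; case: ifPn => [Pj|_]; last first.
    by rewrite !mulr_ge0 ?exprn_ge0 ?expR_ge0.
  rewrite -mulrA ler_peMr// -expRM_natr -expRD -[leLHS]expR0 ler_expR subr_ge0.
  exact: Pc.
rewrite f_pgf ?expR_ge0// ltr_pM2r ?expR_gt0// pgf_lt_expR//.
- by rewrite mulrBr mulr1 addrCA addr_ge0 ?mulr_ge0 ?expR_ge0 ?subr_ge0// ltW.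
- by rewrite -expR0; apply: contra_neq t0; exact: expR_inj.
Qed.

Let mu := n%:R * r.

Let mu_gt0 : 0 < mu. Proof. by apply: mulr_gt0 => //; rewrite ltr0n. Qed.

Lemma chernoff_upper (s : R) : 0 < s ->
  \sum_(j < n.+1 | mu + s <= j%:R) f j < expR (- (s ^+ 2 / (2 * mu + s))).
Proof.
move=> s0; (* Rational substitute for the optimal [ln (1 + s / mu)]. *)
pose t := 2 * s / (2 * mu + s).
have D0 : 0 < 2 * mu + s by move: mu_gt0 s0; rewrite -/mu; lra.
have t0 : 0 < t by apply: divr_gt0 => //; exact: mulr_gt0.
apply: (@lt_le_trans _ _ (expR (mu * (expR t - 1) - t * (mu + s)))).
  by apply: (pgf_markov (P := fun j => mu + s <= j%:R)) => [|j];
    [rewrite gt_eqF|rewrite ler_pM2l].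
rewrite ler_expR.
(* This [t] solves [(2 + t) / (2 - t) = 1 + s / mu], so the Padé bound replaces [mu * (expR t - 1)]
   by exactly [s]. *)
have et : expR t <= 1 + s / mu.
  have := expR_mul_two_sub_le (ltW t0).
  have -> : 2 - t = 4 * mu / (2 * mu + s) by rewrite /t; field; rewrite gt_eqF.
  have -> : 2 + t = (1 + s / mu) * (4 * mu / (2 * mu + s)).
    by rewrite /t; field; rewrite !gt_eqF.
  by rewrite ler_pM2r//; apply: divr_gt0 => //; exact: mulr_gt0.
have -> : - (s ^+ 2 / (2 * mu + s)) = mu * (1 + s / mu - 1) - t * (mu + s).
  by rewrite /t; field; rewrite !gt_eqF.
by rewrite lerD2r ler_pM2l// lerD2r.
Qed.

Lemma chernoff_lower (s : R) : 0 < s ->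
  \sum_(j < n.+1 | j%:R <= mu - s) f j < expR (- (s ^+ 2 / (2 * mu))).
Proof.
(* With [expR (- t)] replaced by its quadratic bound, the exponent is at most
   [mu * t ^+ 2 / 2 - s * t], which is minimal at [t = s / mu]. *)
move=> s0; pose t := s / mu; have t0 : 0 < t by exact: divr_gt0.
apply: (@lt_le_trans _ _ (expR (mu * (expR (- t) - 1) - - t * (mu - s)))).
  apply: (pgf_markov (P := fun j => j%:R <= mu - s)) => [|j js].
    by rewrite oppr_eq0 gt_eqF.
  by rewrite !mulNr lerN2 ler_pM2l.
rewrite ler_expR.
have -> : - (s ^+ 2 / (2 * mu)) = mu * (1 - t + t ^+ 2 / 2 - 1) - - t * (mu - s).
  by rewrite /t; field; rewrite !gt_eqF.
by rewrite lerD2r ler_pM2l// lerD2r expRN_le_quadratic// ltW.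
Qed.

(** The tail denominators [2 * mu + s] and [2 * mu] are both at most [2 * M + s]. The bound [M] on
    the mean allows one exponent to serve all piles, whose means differ. *)
Lemma chernoff_two_sided (M s : R) : mu <= M -> 0 < s ->
  \sum_(j < n.+1 | s <= `|j%:R - mu|) f j < 2 * expR (- (s ^+ 2 / (2 * M + s))).
Proof.
move=> muM s0.
have D0 : 0 < 2 * mu + s by move: mu_gt0 s0; rewrite -/mu; lra.
apply: (@le_lt_trans _ _ (\sum_(j < n.+1 | mu + s <= j%:R) f j +
    \sum_(j < n.+1 | j%:R <= mu - s) f j)).
  rewrite (bigID (fun j : 'I__ => mu + s <= j%:R)) /= lerD//.
    rewrite [leLHS]big_mkcond [leRHS]big_mkcond; apply: ler_sum => j _.
    by case: ifPn => [/andP[_ ->]//|_]; case: ifP.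
  rewrite [leLHS]big_mkcond [leRHS]big_mkcond; apply: ler_sum => j _.
  case: ifPn => [/andP[+ +]|_]; last by case: ifP.
  rewrite -ltNge ler_normr => /orP[|] h1 h2; last by rewrite ifT//; lra.
  by exfalso; lra.
have weaken (c : R) : 0 < c -> c <= 2 * M + s ->
    expR (- (s ^+ 2 / c)) <= expR (- (s ^+ 2 / (2 * M + s))).
  move=> c0 cM; rewrite ler_expR lerN2 ler_pM2l ?exprn_gt0//.
  by rewrite lef_pV2// posrE// (lt_le_trans c0).
rewrite mulr_natl mulr2n ltrD//.
  by apply: (lt_le_trans (chernoff_upper s0)); apply: weaken;
    move: D0 muM; rewrite -/mu; lra.
by apply: (lt_le_trans (chernoff_lower s0)); apply: weaken;
  move: D0 muM mu_gt0; rewrite -/mu; lra.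
Qed.

End binomial_tails.

(** * One move of the solitaire *)

Definition gen (R : realType) (n : nat) (z : nat -> R) (a : weak_comp n) : R :=
  \prod_(k <- finsupp a) z k ^+ a k.

(** Grouping cards by pile turns each power into a product. One factor per card is the form in which
    independence of the picks can be used. *)
Lemma gen_cards (R : realType) n (z : nat -> R) (a : weak_comp n) :
  gen z a = \prod_(c : solitaire_card a) z (val (tag c)).
Proof.
rewrite /gen big_seq_fsetE /=.
under eq_bigr => k _ do rewrite -[X in _ ^+ X]card_ord -prodr_const.
rewrite (sig_big_dep _ (fun k (j : 'I_(a (val k))) => true)
  (fun k (j : 'I_(a (val k))) => z (val k))) /=.
by [].
Qed.

Lemma card_solitaire_card n (a : weak_comp n) : #|{: solitaire_card a}| = n.
Proof.
rewrite -[RHS](parts_sum a) big_seq_fsetE /= card_tagged sumnE big_map big_enum /=.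
by apply: eq_bigr => i _; rewrite card_ord.
Qed.

Lemma card_pile n (a : weak_comp n) (i : nat) :
  #|[set c : solitaire_card a | val (tag c) == i]%SET| = a i.
Proof.
rewrite -sum1_card.
transitivity (\sum_(k : finsupp a) \sum_(j : 'I_(a (val k)) | val k == i) 1)%N.
  by rewrite sig_big_dep; apply: eq_bigl => c; rewrite inE.
under eq_bigr => k _.
  rewrite (_ : (\sum_(j < a (val k) | val k == i) 1)%N =
    if val k == i then a (val k) else 0%N); last first.
    by case: ifP => _; [rewrite sum1_card card_ord|rewrite big_pred0].
  over.
rewrite -big_mkcond /=.
have [ia|ia] := boolP (i \in finsupp a).
  rewrite (big_pred1 [` ia]%fset) //=.
rewrite big_pred0 ?fsfun_dflt// => k.
by apply: contraNF ia => /eqP <-; exact: fsvalP.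
Qed.

(** Trades the truncated subtraction of [after_move] for a cardinal, so that the remaining cards can
    be partitioned by pile. *)
Lemma unpicked n (a : weak_comp n) (S : {set solitaire_card a}) i :
  (a i - picked S i = #|[set c in ~: S | val (tag c) == i]|)%N.
Proof.
rewrite -card_pile /picked.
rewrite -(cardsID S [set c | val (tag c) == i]%SET) addnC.
rewrite (_ : _ :&: S = [set c in S | val (tag c) == i])%SET; last first.
  by apply/setP => c; rewrite !inE andbC.
rewrite addnK; congr #|pred_of_set _|.
by apply/setP => c; rewrite !inE andbC.
Qed.

(** Serves twice: with addition, to show that a move preserves the number of cards, and with
    multiplication, to compute [gen] after a move. For the first use [b] cannot yet be a
    [weak_comp]. Piles emptied by the move are harmless by [F k 0 = idx]. *)
Lemma big_after_move (M : Type) (idx : M) (op : Monoid.com_law idx)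
    (F : nat -> nat -> M) n (a : weak_comp n) (S : {set solitaire_card a})
    (b : {fsfun nat -> nat with 0%N}) :
  (forall k, F k 0%N = idx) -> (forall k, b k = after_move S k) ->
  \big[op/idx]_(k <- finsupp b) F k (b k) =
  op (F 0%N #|S|) (\big[op/idx]_(i : finsupp a)
    F (val i).+1 #|[set c in ~: S | tag c == i]%SET|).
Proof.
move=> F0 bE.
have sub : (finsupp b `<=` 0%N |` [fset i.+1 | i in finsupp a])%fset.
  apply/fsubsetP => -[|i]; rewrite mem_finsupp bE !inE//= => ai.
  apply/imfsetP; exists i => //=; rewrite mem_finsupp.
  by apply: contraNneq ai => ->.
rewrite (big_fset_incl _ sub); last by move=> k _; rewrite memNfinsupp => /eqP ->.
rewrite big_fsetU1/=; last by apply/negP => /imfsetP[].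
rewrite big_imfset/=; last by move=> ? ? _ _ [].
rewrite bE; congr (op _ _); rewrite big_seq_fsetE/=.
by apply: eq_bigr => i _; rewrite bE /= unpicked.
Qed.

Lemma after_move_weak_comp n (a : weak_comp n) (S : {set solitaire_card a}) :
  exists b : weak_comp n, forall k, b k = after_move S k.
Proof.
pose K := (0%N |` [fset i.+1 | i in finsupp a])%fset.
pose b : {fsfun nat -> nat with 0%N} := [fsfun k in K => after_move S k].
have bE k : b k = after_move S k.
  rewrite fsfunE; case: ifPn => //; case: k => [|i]; rewrite !inE//= => Ni.
  rewrite fsfun_dflt ?sub0n//; apply: contra Ni => ia.
  by apply/imfsetP; exists i.
suff bn : (\sum_(k <- finsupp b) b k = n)%N by exists (WeakComp bn).
rewrite (big_after_move _ (F := fun _ x => x) (S := S))//=.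
under eq_bigr => i _ do rewrite -sum1_card.
(* The cards split into the picked ones, forming the new pile, and the others, counted pile by
   pile. *)
rewrite -[RHS](card_solitaire_card a) -(cardsC S) -[in RHS](sum1_card (mem (~: S))).
rewrite (partition_big (fun c => tag c) predT)//=; congr (_ + _)%N.
by apply: eq_bigr => i _; apply: eq_bigl => c; rewrite !inE.
Qed.

Definition moved n (a : weak_comp n) (S : {set solitaire_card a}) : weak_comp n :=
  sval (cid (after_move_weak_comp S)).

Lemma movedE n (a : weak_comp n) (S : {set solitaire_card a}) k :
  moved S k = after_move S k.
Proof. by rewrite /moved; case: cid. Qed.

Lemma weak_comp_inj n (a b : weak_comp n) : (forall k, a k = b k) -> a = b.
Proof.
case: a b => [a an] [b bn] /= /fsfunP ab; subst b.
by congr WeakComp; exact: Prop_irrelevance.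
Qed.

Lemma gen_moved (R : realType) (z : nat -> R) n (a : weak_comp n)
    (S : {set solitaire_card a}) :
  gen z (moved S) =
  \prod_(c : solitaire_card a) if c \in S then z 0%N else z (val (tag c)).+1.
Proof.
rewrite /gen (big_after_move _ (F := fun k x => z k ^+ x) (S := S))//=; last first.
  exact: movedE.
rewrite (bigID (mem S))/=; congr (_ * _).
  rewrite -prodr_const; by apply: eq_bigr => c /= ->.
rewrite (partition_big (fun c => tag c) predT)//=.
apply: eq_bigr => i _; rewrite -prodr_const; apply: eq_big => [c|c].
  by rewrite !inE.
by rewrite !inE => /andP[/negPf -> /eqP ->].
Qed.

Definition shift_gen (R : realType) (p : R) (z : nat -> R) (i : nat) : R :=
  p * z 0%N + (1 - p) * z i.+1.

Definition pick_weight (R : realType) (p : R) n (a : weak_comp n)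
    (S : {set solitaire_card a}) : R :=
  \prod_(c : solitaire_card a) (if c \in S then p else 1 - p).

(** Expanding the product over cards of [p * z 0 + (1 - p) * z i.+1] by distributivity gives one
    term for each set of picked cards. *)
Lemma sum_gen_moved (R : realType) (p : R) (z : nat -> R) n (a : weak_comp n) :
  \sum_(S : {set solitaire_card a}) pick_weight p S * gen z (moved S) =
  gen (shift_gen p z) a.
Proof.
rewrite gen_cards /shift_gen bigA_distr; apply: eq_bigr => S _.
rewrite gen_moved -big_split; apply: eq_bigr => c _ /=.
by case: ifP.
Qed.

(** Each [S] leads to the single state [moved S], so the condition on [S] becomes an indicator
    factor. *)
Lemma transitionE (R : realType) (p : R) n (a b : weak_comp n) :
  transition p a b =
  \sum_(S : {set solitaire_card a}) pick_weight p S * (moved S == b)%:R.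
Proof.
rewrite /transition big_mkcond; apply: eq_bigr => S _.
have -> : `[< forall k : nat, b k = after_move S k >] = (moved S == b).
  apply/asboolP/eqP => [bS|<- k]; last exact: movedE.
  by apply: weak_comp_inj => k; rewrite movedE.
by case: ifP; rewrite (mulr1, mulr0).
Qed.

Lemma gen_cst (R : realType) n c (a : weak_comp n) :
  gen (cst c : nat -> R) a = c ^+ n.
Proof. by rewrite gen_cards prodr_const card_solitaire_card. Qed.

Lemma gen_at (R : realType) n k (x : R) (a : weak_comp n) :
  gen (fun i => if i == k then x else 1) a = x ^+ a k.
Proof.
rewrite /gen; have [ka|ka] := boolP (k \in finsupp a).
  rewrite (big_fsetD1 k)//= eqxx big1_fset ?mulr1// => i.
  by rewrite !inE => /andP[/negPf -> _]; rewrite expr1n.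
rewrite [in RHS]fsfun_dflt// expr0 big1_fset// => i ia _.
by case: eqP ia ka => [->->//|_ _ _]; rewrite expr1n.
Qed.

(** Since [0 ^+ 0 = 1], a product of 0/1 weights vanishes exactly when some pile of weight 0 is
    nonempty. *)
Lemma gen_below (R : realType) n m (a : weak_comp n) :
  gen (fun i => (i < m)%N%:R : R) a =
  `[< forall k : nat, (m <= k)%N -> a k = 0%N >]%:R.
Proof.
rewrite /gen; case: asboolP => [am|/existsNP[k /not_implyP[mk /eqP ak]]].
  rewrite big1_fset// => i ia _.
  have [im|mi] := ltnP i m; first by rewrite expr1n.
  by rewrite am.
rewrite (big_fsetD1 k)/= ?mem_finsupp// ltnNge mk expr0n.
by rewrite (negPf ak) mul0r.
Qed.

Lemma shift_gen_ge0 (R : realType) (p : R) (z : nat -> R) k : 0 <= p <= 1 ->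
  (forall i, 0 <= z i) -> 0 <= shift_gen p z k.
Proof.
by move=> /andP[p0 p1] z0; rewrite addr_ge0 ?mulr_ge0 ?subr_ge0.
Qed.

Lemma leq_part n (a : weak_comp n) k : (a k <= n)%N.
Proof. by rewrite -card_pile -[X in (_ <= X)%N](card_solitaire_card a) max_card. Qed.

(** * The Markov chain *)

Lemma measurable_rv_preimage d (T : measurableType d) (R : realType)
    (P : probability T R) n (X : {RV P >-> weak_comp n})
    (B : set (weak_comp n)) :
  measurable [set w | B (X w)].
Proof.
have := measurable_funPT X measurableT B I.
by rewrite setTI.
Qed.

Lemma measurable_fun_rv d (T : measurableType d) (R : realType)
    (P : probability T R) n (X : {RV P >-> weak_comp n}) D (g : weak_comp n -> R) :
  measurable_fun D (EFin \o (fun w => g (X w))).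
Proof.
apply/measurable_EFinP; apply: measurable_funS (measurableT) _ _ => //.
move=> _ B mB; rewrite setTI.
exact: (measurable_rv_preimage X (g @^-1` B)).
Qed.

(** Numbers the states, so that countable unions and series over states can be indexed by [nat]. *)
Definition code n (a : weak_comp n) : nat := choice.pickle (parts a).

Lemma code_inj n : injective (@code n).
Proof.
move=> a b /(pcan_inj (@choice.pickleK _)) ab; apply: weak_comp_inj => k.
by rewrite ab.
Qed.

Lemma integral_fibers d (T : measurableType d) (R : realType)
    (P : probability T R) n (X : {RV P >-> weak_comp n}) D (f : T -> \bar R) :
  measurable D -> measurable_fun setT f -> (forall w, 0 <= f w)%E ->
  (\int[P]_(w in D) f w =
   \sum_(i <oo) \int[P]_(w in D `&` [set w | code (X w) = i]) f w)%E.
Proof.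
move=> mD mf f0.
pose F i := D `&` [set w | code (X w) = i].
have DF : D = \bigcup_i F i.
  by rewrite eqEsubset; split => [w Dw|w [i _ []//]]; exists (code (X w)).
rewrite {1}DF ge0_integral_bigcup//.
- move=> i; apply: measurableI => //.
  exact: (measurable_rv_preimage X [set a | code a = i]).
- exact: measurable_funS mf.
- by move=> i j _ _ [w [[_ <-] [_ <-]]].
Qed.

(** By countable additivity it suffices to compare the integrals on each fibre of [X]; this plays
    the part of conditioning on the value of [X]. *)
Lemma eq_integral_fibers d (T : measurableType d) (R : realType)
    (P : probability T R) n (X : {RV P >-> weak_comp n}) D (f g : T -> \bar R) :
  measurable D -> measurable_fun setT f -> measurable_fun setT g ->
  (forall w, 0 <= f w)%E -> (forall w, 0 <= g w)%E ->
  (forall b, \int[P]_(w in D `&` [set w | X w = b]) f w =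
             \int[P]_(w in D `&` [set w | X w = b]) g w)%E ->
  (\int[P]_(w in D) f w = \int[P]_(w in D) g w)%E.
Proof.
move=> mD mf mg f0 g0 fg; rewrite !(integral_fibers X)//.
apply: eq_eseriesr => i _.
have [[b <-]|Ni] := pselect (exists b : weak_comp n, code b = i).
  rewrite (_ : [set w | code (X w) = code b] = [set w | X w = b])//.
  by rewrite eqEsubset; split => w /= => [/code_inj|->].
(* Indices that code no state have an empty fibre. *)
rewrite (_ : D `&` _ = set0) ?integral_set0//.
by rewrite -subset0 => w [_ /= wi]; apply: Ni; exists (X w).
Qed.

Lemma gen_ge0 (R : realType) n (z : nat -> R) (a : weak_comp n) :
  (forall k, 0 <= z k) -> 0 <= gen z a.
Proof. by move=> z0; apply: prodr_ge0 => k _; exact: exprn_ge0. Qed.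

Section chain.
Variables (R : realType) (d : measure_display) (T : measurableType d).
Variables (P : probability T R) (n : nat) (p : R).
Variable alpha : nat -> {RV P >-> weak_comp n}.
Hypotheses (p_ge0 : 0 <= p) (p_le1 : p <= 1).
Hypothesis alphaP : stochastic_bulgarian_solitaire p alpha.

Definition history (t : nat) (h : nat -> weak_comp n) : set T :=
  [set w | forall s, (s <= t)%N -> alpha s w = h s].

Lemma historyS t h :
  history t.+1 h = history t h `&` [set w | alpha t.+1 w = h t.+1].
Proof.
rewrite eqEsubset; split => w /=.
  by move=> wh; split => [s st|]; apply: wh => //; exact: leqW.
by move=> [wh wt] s; rewrite leq_eqVlt => /predU1P[->//|]; rewrite ltnS; exact: wh.
Qed.

Lemma history0 h : history 0 h = [set w | alpha 0%N w = h 0%N].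
Proof.
rewrite eqEsubset; split => w /=; first by apply.
by move=> w0 s; rewrite leqn0 => /eqP ->.
Qed.

Lemma measurable_history t h : measurable (history t h).
Proof.
elim: t => [|t IH]; first by rewrite history0; exact: (measurable_rv_preimage _ [set h 0%N]).
rewrite historyS; apply: measurableI => //.
exact: (measurable_rv_preimage _ [set h t.+1]).
Qed.

(** The Markov hypothesis speaks of a single path [h]; replacing its values after time [t] lets the
    next state vary while the past stays fixed. *)
Definition extend (t : nat) (h : nat -> weak_comp n) (b : weak_comp n) (s : nat) :=
  if (s <= t)%N then h s else b.

Lemma history_extend0 t h b : history t (extend t h b) = history t h.
Proof. by rewrite eqEsubset; split => w wh s st; rewrite wh// /extend st. Qed.

Lemma history_extend t h b :
  history t.+1 (extend t h b) = history t h `&` [set w | alpha t.+1 w = b].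
Proof. by rewrite historyS history_extend0 {1}/extend ltnn. Qed.

Lemma pick_weight_ge0 (a : weak_comp n) (S : {set solitaire_card a}) :
  0 <= pick_weight p S.
Proof. by apply: prodr_ge0 => c _; case: ifP => _ //; rewrite subr_ge0. Qed.

Lemma P_next t h b :
  P (history t h `&` [set w | alpha t.+1 w = b]) =
  (P (history t h) * (transition p (h t) b)%:E)%E.
Proof.
have := alphaP t (extend t h b); rewrite -!/(history _ _) history_extend.
by rewrite history_extend0 {1 2}/extend ltnn leqnn.
Qed.

(** On this event [alpha t] is the constant [h t]. Splitting by the next state and inserting the
    transition probabilities leaves a sum over picked sets, which [sum_gen_moved] evaluates. *)
Lemma integral_gen_history t h (z : nat -> R) : (forall k, 0 <= z k) ->
  (\int[P]_(w in history t h) (gen z (alpha t.+1 w))%:E =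
   \int[P]_(w in history t h) (gen (shift_gen p z) (alpha t w))%:E)%E.
Proof.
move=> z0; have mH := measurable_history t h.
have fin : P (history t h) \is a fin_num by exact: fin_num_measure.
transitivity (P (history t h) * (gen (shift_gen p z) (h t))%:E)%E; last first.
  rewrite muleC -(integral_cst P mH (gen _ _)%:E).
  by apply: eq_integral => w; rewrite inE => wh; rewrite wh.
rewrite (integral_fibers (alpha t.+1))//; last 2 first.
  - exact: measurable_fun_rv.
  - by move=> w; rewrite lee_fin gen_ge0.
(* Contribution of the picked set [S] to the next state coded by [i]. Nonnegativity allows the
   series over [i] and the finite sum over [S] to be exchanged. *)
pose G (S : {set solitaire_card (h t)}) (i : nat) : \bar R :=
  (P (history t h) * (pick_weight p S * gen z (moved S))%:E *
    ((code (moved S) == i)%:R)%:E)%E.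
have G0 S i : (0 <= G S i)%E.
  by rewrite !mule_ge0// lee_fin ?ler0n// mulr_ge0 ?pick_weight_ge0 ?gen_ge0.
transitivity (\sum_(i <oo) \sum_S G S i)%E.
  apply: eq_eseriesr => i _.
  have [[b <-]|Ni] := pselect (exists b : weak_comp n, code b = i).
    rewrite (_ : [set w | code (alpha t.+1 w) = code b] = [set w | alpha t.+1 w = b]);
      last first.
      by rewrite eqEsubset; split => w /= => [/code_inj|->].
    transitivity ((gen z b)%:E * P (history t h `&` [set w | alpha t.+1 w = b]))%E.
      rewrite -integral_cst; last first.
        by apply: measurableI => //; exact: (measurable_rv_preimage _ [set b]).
      by apply: eq_integral => w; rewrite inE => -[_ /= ->].
    rewrite P_next transitionE -(fineK fin) /G -(fineK fin).
    under [RHS]eq_bigr => S _ do rewrite -!EFinM.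
    rewrite -!EFinM sumEFin; congr _%:E; rewrite mulrCA mulr_sumr mulr_sumr.
    apply: eq_bigr => S _; rewrite (inj_eq (@code_inj n)).
    by case: eqP => [->|_] /=; ring.
  rewrite (_ : _ `&` _ = set0); last first.
    by rewrite -subset0 => w [_ /= wi]; apply: Ni; exists (alpha t.+1 w).
  rewrite integral_set0 big1// => S _; rewrite /G.
  case: eqP => [Si|_]; last by rewrite mule0.
  by exfalso; apply: Ni; exists (moved S).
rewrite nneseries_sum//.
under eq_bigr => S _.
  rewrite (_ : (\sum_(i <oo) _)%E =
    (P (history t h) * (pick_weight p S * gen z (moved S))%:E)%E).
    over.
  (* For fixed [S] only the index [code (moved S)] contributes. *)
  rewrite (@nneseriesD1 _ (G S) (code (moved S)) xpredT)//.
  rewrite {1}/G eqxx mule1 eseries0 ?adde0// => i _ Ni.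
  by rewrite /G eq_sym (negPf Ni) mule0.
rewrite -(fineK fin); under eq_bigr => S _ do rewrite -EFinM.
by rewrite sumEFin -EFinM -mulr_sumr sum_gen_moved.
Qed.

(* The Markov property is only available on events fixing the whole history, so
   the past is summed out one state at a time. *)
Lemma integral_gen_history_le j s h (z : nat -> R) : (forall k, 0 <= z k) ->
  (\int[P]_(w in history s h) (gen z (alpha (s + j).+1 w))%:E =
   \int[P]_(w in history s h) (gen (shift_gen p z) (alpha (s + j) w))%:E)%E.
Proof.
move=> z0; elim: j s h => [|j IH] s h; first by rewrite addn0 integral_gen_history.
apply: (eq_integral_fibers (X := alpha s.+1)).
- exact: measurable_history.
- exact: measurable_fun_rv.
- exact: measurable_fun_rv.
- by move=> w; rewrite lee_fin gen_ge0.
- by move=> w; rewrite lee_fin gen_ge0// => k;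
  by apply: shift_gen_ge0 => //; apply/andP.
(* Fixing the state at time [s.+1] lengthens the history by one and shortens the gap [j] by one. *)
- by move=> b; rewrite -history_extend addnS -addSn IH.
Qed.

Lemma integral_genS t (z : nat -> R) : (forall k, 0 <= z k) ->
  (\int[P]_w (gen z (alpha t.+1 w))%:E =
   \int[P]_w (gen (shift_gen p z) (alpha t w))%:E)%E.
Proof.
move=> z0; apply: (eq_integral_fibers (X := alpha 0%N)) => //.
- exact: measurable_fun_rv.
- exact: measurable_fun_rv.
- by move=> w; rewrite lee_fin gen_ge0.
- by move=> w; rewrite lee_fin gen_ge0// => k;
  by apply: shift_gen_ge0 => //; apply/andP.
- move=> b; rewrite setTI -(history0 (fun=> b)).
  exact: (integral_gen_history_le t 0 _ z0).
Qed.

Lemma integral_gen_iter t (z : nat -> R) c : (forall k, 0 <= z k) ->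
  iter t (shift_gen p) z = cst c ->
  (\int[P]_w (gen z (alpha t w))%:E = (c ^+ n)%:E)%E.
Proof.
elim: t z => [|t IH] z z0 zc.
  move: zc => /= ->; under eq_integral => w _ do rewrite gen_cst.
  by rewrite integral_cst//= probability_setT mule1.
rewrite (integral_genS t z0) IH//; last by rewrite -iterSr.
by move=> k;
  by apply: shift_gen_ge0 => //; apply/andP.
Qed.

Lemma pgf_alpha m k x : (k < m)%N -> 0 <= x ->
  (\int[P]_w (x ^+ alpha m w k)%:E =
   ((1 + p * (1 - p) ^+ k * (x - 1)) ^+ n)%:E)%E.
Proof.
move=> km x0; pose z i := if i == k then x else 1.
have z0 i : 0 <= z i by rewrite /z; case: ifP.
rewrite -(integral_gen_iter (t := m) z0).
  by apply: eq_integral => w _; rewrite gen_at.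
(* The perturbed weight moves down one index per iteration and shrinks by [1 - p]; [i + j == k]
   locates it at index [k - j]. *)
have iterE j : (j <= k)%N -> iter j (shift_gen p) z =
    fun i => 1 + (1 - p) ^+ j * (x - 1) * (i + j == k)%N%:R.
  elim: j => [|j IH] jk; apply/funext => i.
    by rewrite /= addn0 /z expr0; case: eqP => _ /=; ring.
  rewrite iterS (IH (ltnW jk)) /shift_gen add0n (ltn_eqF jk) addSnnS exprS mulr0 addr0; ring.
(* Iteration [k.+1] finds the perturbation at index 0, which enters every new weight with factor
   [p]. The weights are then constant, and [shift_gen p] fixes constants. *)
rewrite -(subnK km); elim: (m - k.+1)%N => [|j IH].
  rewrite add0n iterS iterE//; apply/funext => i.
  by rewrite /shift_gen /= add0n eqxx -[X in _ == X]add0n eqn_add2r/=; ring.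
by rewrite addSn iterS IH; apply/funext => i; rewrite /shift_gen /=; ring.
Qed.

(** Cards in piles of index at least [m] are those never picked in [m] moves; each card
    independently avoids this with probability [1 - (1 - p) ^+ m]. *)
Lemma prob_no_old_piles m :
  P [set w | forall k : nat, (m <= k)%N -> alpha m w k = 0%N] =
  ((1 - (1 - p) ^+ m) ^+ n)%:E.
Proof.
pose z i : R := (i < m)%N%:R.
have mA : measurable [set w | forall k : nat, (m <= k)%N -> alpha m w k = 0%N].
  exact: (measurable_rv_preimage (alpha m) [set a | forall k, (m <= k)%N -> a k = 0%N]).
rewrite -(integral_gen_iter (t := m) (z := z)).
- rewrite -[X in P X]setIT -integral_indic//; apply: eq_integral => w _.
  rewrite gen_below indicE; congr ((nat_of_bool _)%:R%:E).
- by move=> k; rewrite ler0n.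
(* As long as [j < m], index 0 has weight 1, and [p + (1 - p) * (1 - (1 - p) ^+ j) = 1 - (1 - p) ^+
   j.+1]. At [j = m] no index satisfies [i + j < m], so the weights are constant. *)
have iterE j : (j <= m)%N -> iter j (shift_gen p) z =
    fun i => if (i + j < m)%N then 1 else 1 - (1 - p) ^+ j.
  elim: j => [|j IH] jm; apply/funext => i.
    by rewrite /= addn0 /z expr0 subrr; case: ifP.
  rewrite iterS (IH (ltnW jm)) /shift_gen add0n jm addSnnS.
  by case: ifP => _; rewrite ?exprS; ring.
by rewrite iterE//; apply/funext => i; rewrite ltnNge leq_addl.
Qed.

End chain.

(** * Law of a single part, and the union bound over piles *)

Lemma expectation_part d (T : measurableType d) (R : realType)
    (P : probability T R) n (X : {RV P >-> weak_comp n}) k (g : nat -> R) : (forall j, 0 <= g j) ->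
  (\int[P]_w (g (X w k))%:E =
   (\sum_(j < n.+1) fine (P [set w | X w k = j]) * g j)%:E)%E.
Proof.
move=> g0; pose A j := [set w | X w k = j].
have mA j : measurable (A j) by exact: (measurable_rv_preimage X [set a | a k = j]).
(* A part is at most [n], so exactly one of these indicators equals 1. *)
transitivity (\int[P]_w (\sum_(j < n.+1) (g j)%:E * (\1_(A j) w)%:E))%E.
  apply: eq_integral => w _; pose i := Ordinal (leq_part (X w) k : (_ < n.+1)%N).
  rewrite (bigD1 i)//= indicE mem_set// mule1 big1 ?adde0// => j ji.
  rewrite indicE memNset ?mule0// /A /= => wj; move/eqP: ji; apply.
  exact/val_inj/esym.
rewrite ge0_integral_sum//; last 2 first.
- by move=> j; apply: measurable_funeM; apply/measurable_EFinP; exact: measurable_indic.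
- by move=> j w _; rewrite mule_ge0// lee_fin.
rewrite -sumEFin; apply: eq_bigr => j _.
rewrite ge0_integralZl//; last 2 first.
- by apply/measurable_EFinP; exact: measurable_indic.
- by rewrite lee_fin; exact: g0.
rewrite integral_indic// setIT muleC EFinM fineK//.
exact: (fin_num_measure P _ (mA j)).
Qed.

Lemma bernoulli_ineq (R : realDomainType) (x : R) n : 0 <= x <= 1 ->
  1 - n%:R * x <= (1 - x) ^+ n.
Proof.
move=> /andP[x0 x1]; elim: n => [|n IH]; first by rewrite mul0r subr0 expr0.
rewrite exprS; apply: (@le_trans _ _ ((1 - x) * (1 - n%:R * x))).
  rewrite -natr1 -subr_ge0 (_ : _ - _ = n%:R * x ^+ 2); last by ring.
  by rewrite mulr_ge0 ?exprn_ge0.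
by rewrite ler_wpM2l ?subr_ge0.
Qed.

Theorem theorem2 (R : realType) (d : measure_display) (T : measurableType d)
    (P : probability T R) (n : nat) (p : R)
    (alpha : nat -> {RV P >-> weak_comp n})
    (n_gt0 : (0 < n)%N) (p_gt0 : 0 < p) (p_lt1 : p < 1)
    (alphaP : stochastic_bulgarian_solitaire p alpha)
    (e : R) (e_gt0 : 0 < e) (m : nat) (m_ge1 : (1 <= m)%N) :
  ((1 - 2 * m%:R * expR (- (e ^+ 2 / (2 + e) * (n%:R * p))))%:E <
     P [set w | forall k : nat, (k < m)%N ->
          `| ((alpha m w k)%:R : R)%:E
             - 'E_P[(fun w' : T => (alpha m w' k)%:R : R)] | <
          (e * (n%:R * p))%:E])%E
  /\
  ((1 - n%:R * (1 - p) ^+ m)%:E <=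
     P [set w | forall k : nat, (m <= k)%N -> alpha m w k = 0%N])%E.
Proof.
have p_ge0 := ltW p_gt0; have p_le1 := ltW p_lt1.
have q_gt0 : 0 < 1 - p by rewrite subr_gt0.
have q_le1 : 1 - p <= 1 by rewrite gerBl.
split; last first.
  rewrite (prob_no_old_piles p_ge0 p_le1 alphaP) lee_fin bernoulli_ineq//.
  by rewrite exprn_ge0 ?exprn_ile1// ltW.
set E := expR _; set s := e * (n%:R * p).
have s_gt0 : 0 < s by rewrite !mulr_gt0 ?ltr0n.
(* Probability that a given card ends in pile [k]: it is picked once, then left alone in the [k]
   following moves. *)
pose r k := p * (1 - p) ^+ k.
have r_gt0 k : 0 < r k by rewrite mulr_gt0 ?exprn_gt0.
have r_lep k : r k <= p by rewrite ler_piMr ?exprn_ile1// ltW.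
pose f k j := fine (P [set w | alpha m w k = j]).
have f_ge0 k j : 0 <= f k j by rewrite fine_ge0.
have f_pgf k : (k < m)%N -> forall z, 0 <= z ->
    \sum_(j < n.+1) f k j * z ^+ j = (1 + r k * (z - 1)) ^+ n.
  move=> km z z0; apply: EFin_inj; rewrite -(pgf_alpha p_ge0 p_le1 alphaP km z0).
  by rewrite (expectation_part (alpha m) k (g := fun j => z ^+ j))// => j; exact: exprn_ge0.
have mean k : (k < m)%N -> ('E_P[(fun w => (alpha m w k)%:R : R)] = (n%:R * r k)%:E)%E.
  move=> km; rewrite unlock (expectation_part (alpha m) k (g := fun j => j%:R))//.
  by rewrite -(pgf_mean (f_pgf k km)); congr _%:E; apply: eq_bigr => j _; rewrite mulrC.
pose far k j := s <= `|j%:R - n%:R * r k|.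
pose B k := [set w | far k (alpha m w k)].
have mB k : measurable (B k) by exact: (measurable_rv_preimage _ [set a | far k (a k)]).
have PB k : P (B k) = (\sum_(j < n.+1 | far k j) f k j)%:E.
  rewrite -[B k]setIT -integral_indic//.
  transitivity (\int[P]_w ((far k (alpha m w k))%:R)%:E)%E.
    by apply: eq_integral => w _; rewrite indicE;
      congr ((nat_of_bool _)%:R%:E); apply/idP/idP; rewrite inE.
  rewrite (expectation_part (alpha m) k (g := fun j => (far k j)%:R))//.
  congr _%:E; rewrite [RHS]big_mkcond; apply: eq_bigr => j _.
  by case: ifP; rewrite (mulr1, mulr0).
have PBlt k : (k < m)%N -> (\sum_(j < n.+1 | far k j) f k j) < 2 * E.
  move=> km.
  have := @chernoff_two_sided _ n (r k) (f k) n_gt0 (r_gt0 k) (le_trans (r_lep k) p_le1)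
    (f_ge0 k) (f_pgf k km) (n%:R * p) s.
  (* With [M = n%:R * p], which bounds every mean [n%:R * r k], the Chernoff exponent is the one of
     the theorem for all [k]. *)
  rewrite (_ : s ^+ 2 / (2 * (n%:R * p) + s) = e ^+ 2 / (2 + e) * (n%:R * p)); last first.
    have M0 : 0 < n%:R * p by rewrite mulr_gt0 ?ltr0n.
    have e2 : 0 < 2 + e by rewrite addr_gt0.
    by rewrite /s; field; rewrite -mulrDl mulf_neq0 gt_eqF.
  by move=> ch; apply: ch => //; rewrite ler_pM2l ?ltr0n.
(* The event is the complement of the union of the [m] deviation events [B k], to which Boole's
   inequality applies. *)
rewrite (_ : [set w | _] = ~` \big[setU/set0]_(k < m) B k); last first.
  rewrite eqEsubset; split => w /= => [wk|wB k km].
    rewrite -bigcup_mkord => -[k /= km]; rewrite /B /= /far leNgt => /negP; apply.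
    by have := wk k km; rewrite (mean k km) -EFinB /= lte_fin.
  rewrite (mean k km) -EFinB /= lte_fin ltNge; apply/negP => wk; apply: wB.
  by rewrite -bigcup_mkord; exists k.
have mU : measurable (\big[setU/set0]_(k < m) B k) by exact: bigsetU_measurable.
rewrite probability_setC// -(fineK (fin_num_measure P _ mU)) EFinB lte_fin.
rewrite ltrD2l ltrN2; apply: (@le_lt_trans _ _
  (\sum_(k < m) \sum_(j < n.+1 | far k j) f k j)).
  rewrite -lee_fin fineK ?fin_num_measure//; apply: (le_trans (Boole_inequality P _)) => //.
  by rewrite -sumEFin; apply: lee_sum => k _; rewrite -PB.
have -> : 2 * m%:R * E = \sum_(k < m) 2 * E.
  by rewrite sumr_const card_ord -[RHS]mulr_natl; ring.
(* A sum of strict inequalities is strict only over a nonempty range: [1 <= m] supplies an index. *)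
apply: ltr_sum => [|k _]; last exact: PBlt.
by apply/hasP; exists (Ordinal m_ge1) => //; rewrite mem_index_enum.
Qed.
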